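(* There exist constants $C>0$ and $N_0$ such that for every $N=2^n\ge N_0$, every integer $M$ with $N<M\le 2^N$, and every set $S$ of $M$ distinct Boolean functions $f:\{0,1\}^n\to\{0,1\}$ (i.e. every $N\times M$ oracle identification problem with $M>N$), the bounded-error quantum query complexity $Q(S)$ of identifying the input oracle from $S$ satisfies $$Q(S)\le C\,\sqrt{N\log M\,\log N}\;\log\log M .$$
   Context: Let $N=2^n$; logarithms are base 2. An oracle is a Boolean function $f:\{0,1\}^n\to\{0,1\}$, and inputs are identified with integers $0,\dots,N-1$ via binary representation. A set $S=\{f_0,\dots,f_{M-1}\}$ of $M$ distinct oracles is viewed as a Boolean matrix with $M$ rows (oracles) and $N$ columns (inputs), called an $N\times M$ matrix; the entry in row $i$, column $j$ is $f_i(j)$. The $N\times M$ oracle identification problem (OIP) for $S$: the set $S$ is completely known, an unknown $f\in S$ (the input oracle) is given as a black box, and the task is to determine which element of $S$ it is. A quantum algorithm with $t$ queries is a sequence $U_0,O_f,U_1,O_f,\dots,O_f,U_t$ applied to a fixed initial state (with arbitrary finite workspace), followed by a measurement producing the output, where the $U_j$ are arbitrary unitaries independent of $f$ and $O_f$ maps $|x\rangle|b\rangle$ to $(-1)^{b\cdot f(x)}|x\rangle|b\rangle$ for $x\in\{0,1\}^n$, $b\in\{0,1\}$ (identity on the rest of the workspace). It solves the OIP for $S$ with bounded error if for every $f\in S$, when run with $O_f$, it outputs (the index of) $f$ with probability at least $2/3$. $Q(S)$ is the minimum $t$ for which such an algorithm exists. *)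

(* Defs.v *)
From mathcomp Require Import all_boot all_order all_algebra.
From mathcomp Require Import all_classical all_reals all_analysis.
From mathcomp Require Export complex.

Set Implicit Arguments.
Unset Strict Implicit.
Unset Printing Implicit Defensive.

Import Order.TTheory GRing.Theory Num.Theory.
Local Open Scope ring_scope.
Local Open Scope sesquilinear_scope.

Definition oracle (n : nat) := {ffun n.-tuple bool -> bool}.

Definition log2 (R : realType) (x : R) : R := ln x / ln 2.

(* The basis state |x>|b>|w> is the triple (x, b, w); [enum_val] and [enum_rank]
   translate between triples and matrix indices. *)
Definition basis (n : nat) (W : finType) : finType :=
  (n.-tuple bool * bool * W)%type.

Definition state (R : realType) (n : nat) (W : finType) :=
  'cV[R[i]]_#|basis n W|.

Definition operator (R : realType) (n : nat) (W : finType) :=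
  'M[R[i]]_#|basis n W|.

Definition sqnorm (R : realType) (d : nat) (v : 'cV[R[i]]_d) : R[i] :=
  \sum_i `|v i 0| ^+ 2.

Definition oracle_op (R : realType) (n : nat) (W : finType) (f : oracle n) :
    operator R n W :=
  diag_mx (\row_i let: (x, b, _) := enum_val i in (-1) ^+ (b && f x)).

(* The final measurement is an arbitrary quantum measurement, given by its
   measurement operators: outcome [g] has probability |M_g psi|^2. Outcomes are
   oracles; those outside of the set under consideration are wrong answers. *)
Record query_algorithm (R : realType) (n t : nat) := QueryAlgorithm {
  workspace : finType;
  init : state R n workspace;
  init_unit : sqnorm init = 1;
  gate : 'I_t.+1 -> operator R n workspace;
  gate_unitary : forall j, gate j \is unitarymx;
  meas : oracle n -> operator R n workspace;
  meas_complete : \sum_g (meas g)^t* *m meas g = 1%:M }.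

(* [run A f k] is U_k O_f U_(k-1) ... O_f U_0 |init>; it is used for k <= t. *)
Fixpoint run (R : realType) (n t : nat) (A : query_algorithm R n t)
    (f : oracle n) (k : nat) : state R n (workspace A) :=
  if k is k'.+1 then
    gate A (inord k) *m (oracle_op R (workspace A) f *m run A f k')
  else gate A ord0 *m init A.

Definition output_prob (R : realType) (n t : nat) (A : query_algorithm R n t)
    (f g : oracle n) : R[i] :=
  sqnorm (meas A g *m run A f t).

Definition solves (R : realType) (n t : nat) (A : query_algorithm R n t)
    (S : {set oracle n}) : Prop :=
  forall f, f \in S -> 2 / 3 <= output_prob A f f.

Definition identifiable (R : realType) (n : nat) (S : {set oracle n})
    (t : nat) : Prop :=
  exists A : query_algorithm R n t, solves A S.

(* The minimum is +oo, rather than a junk natural number, if there is no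
   algorithm. *)
Definition query_complexity (R : realType) (n : nat) (S : {set oracle n}) :
    \bar R :=
  if pselect (exists t, `[< identifiable R S t >]) is left ex
  then (ex_minn ex)%:R%:E else +oo%E.

(* Main.v *)
Require Import Defs.
From mathcomp Require Import all_boot all_order all_algebra.
From mathcomp Require Import all_classical all_reals all_analysis.
From mathcomp Require Import ring lra zify.

(* Halving, with a Grover search for a mistake of the majority vote. Split the N
   inputs into K ~ log M blocks of size about N / K, and let C be the set of the
   candidates that are still possible. A stage picks a block D on which the
   candidates differ and searches D for an input at which f deviates from the
   majority of C. If one is found, and verified by one more query, at least half
   of the candidates are eliminated; if D contains none, the values of f on D are
   known. So log M + K stages suffice. As in every stage an error of order 1 / K
   is affordable, it consists of O(log K) repetitions of a search with
   O(sqrt(N / K)) queries, which gives O(sqrt(N log M) log log M) in total.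

   The number of solutions in D is unknown, so a search tries (3^k - 1) / 2
   Grover iterations for k = 0, ..., L, where 9^L >= #|D|: one of the angles
   3^k * theta has sine at least 1/2.

   The adaptive algorithm becomes a circuit by deferring measurements: each
   outcome is swapped into a fresh slot of the workspace, which only controls
   later gates. All amplitudes are real, so gates are norm-preserving linear maps
   on real functions of the basis states. *)

Set Implicit Arguments.
Unset Strict Implicit.
Unset Printing Implicit Defensive.
Import Order.TTheory GRing.Theory Num.Theory.
Local Open Scope ring_scope.
Local Open Scope complex_scope.
Local Open Scope sesquilinear_scope.

(** * Real amplitudes *)

Definition norm2 (R : realType) (E : finType) (psi : E -> R) : R :=
  \sum_e psi e ^+ 2.

Definition isometry (R : realType) (E : finType)
    (T : (E -> R) -> (E -> R)) : Prop :=
  (forall a psi phi e, T (fun e => a * psi e + phi e) e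
     = a * T psi e + T phi e) /\
  (forall psi, norm2 (T psi) = norm2 psi).

Section RealVectors.
Variables (R : realType) (E : finType).
Implicit Types (psi phi : E -> R) (T : (E -> R) -> (E -> R)).

Definition cvec psi : 'cV[R[i]]_#|E| := \col_k (psi (enum_val k))%:C.

Definition delta (y : E) : E -> R := fun e => (e == y)%:R.

Lemma sum_delta (F : E -> R) y : \sum_e delta y e * F e = F y.
Proof.
rewrite (bigD1 y) //= big1 => [|e /negPf ney]; rewrite /delta ?ney ?mul0r //.
by rewrite eqxx mul1r addr0.
Qed.

Lemma norm2_delta y : norm2 (delta y) = 1.
Proof.
rewrite /norm2; under eq_bigr do rewrite expr2.
by rewrite sum_delta /delta eqxx.
Qed.

Lemma sum_enum_val (V : nmodType) (F : E -> V) :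
  \sum_(k < #|E|) F (enum_val k) = \sum_e F e.
Proof. by rewrite -big_enum_val. Qed.

Lemma normC_real (x : R) : `|x%:C| ^+ 2 = (x ^+ 2)%:C :> R[i].
Proof. by rewrite -add_Re2_Im2 /= expr0n addr0. Qed.

Lemma conj_real (x : R) : Num.conj (x%:C) = x%:C :> R[i].
Proof.
by apply: conj_Creal; rewrite realE !lecE /= eqxx /= -realE num_real.
Qed.

Lemma sqnorm_cvec psi : sqnorm (cvec psi) = (norm2 psi)%:C.
Proof.
rewrite /sqnorm /norm2 rmorph_sum -[RHS]sum_enum_val.
by apply: eq_bigr => k _; rewrite mxE normC_real.
Qed.

Lemma isometry_scale T a psi : isometry T ->
  T (fun e => a * psi e) = fun e => a * T psi e.
Proof.
move=> [lin _]; apply/funext => e.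
have T0 : T (fun=> 0) e = 0.
  transitivity (T (fun x => -1 * 0 + 0) e); last by rewrite lin mulN1r addNr.
  by congr (T _ e); apply/funext => x; rewrite mulN1r addNr.
have := lin a psi (fun=> 0) e; rewrite T0 addr0 => <-.
by congr (T _ e); apply/funext => x; rewrite addr0.
Qed.

Lemma isometry_sum T (I : Type) (r : seq I) (a : I -> R) (phi : I -> E -> R) :
  isometry T ->
  T (fun e => \sum_(i <- r) a i * phi i e) =
  fun e => \sum_(i <- r) a i * T (phi i) e.
Proof.
move=> isoT; elim: r => [|i r IH]; apply/funext => e.
  transitivity (T (fun x => 0 * 0) e).
    by congr (T _ e); apply/funext => x; rewrite big_nil mul0r.
  by rewrite (isometry_scale 0 (fun=> 0) isoT) big_nil mul0r.
rewrite big_cons.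
rewrite -[X in _ + X]/((fun e => \sum_(i <- r) a i * T (phi i) e) e) -IH.
by rewrite -isoT.1; congr (T _ e); apply/funext => x; rewrite big_cons.
Qed.

(** By polarization, the dot product is a combination of squared norms. *)
Lemma isometry_dot T psi phi : isometry T ->
  \sum_e T psi e * T phi e = \sum_e psi e * phi e.
Proof.
move=> [lin nrm].
have pol (u v : E -> R) : \sum_e u e * v e =
    (norm2 (fun e => 1 * u e + v e) - norm2 u - norm2 v) / 2.
  rewrite /norm2 -!sumrB mulr_suml; apply: eq_bigr => e _.
  by field.
rewrite !pol !nrm -(nrm (fun e => 1 * psi e + phi e)).
congr ((norm2 _ - _ - _) / 2).
by apply/funext => e; rewrite lin.
Qed.

Lemma isometry_unitary T : isometry T ->
  exists2 A : 'M[R[i]]_#|E|, A \is unitarymx &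
    forall psi, A *m cvec psi = cvec (T psi).
Proof.
move=> isoT; exists (\matrix_(i, j) (T (delta (enum_val j)) (enum_val i))%:C).
  apply/unitarymxP; set A := (X in X *m _ = _).
  (* The columns are the images of the basis vectors, so orthonormality follows from [isometry_dot];
     a left inverse of a square matrix is a right inverse. *)
  apply: mulmx1C; apply/matrixP => j k; rewrite !mxE.
  under eq_bigr => i _.
    rewrite !mxE conj_real -rmorphM.
  over.
  rewrite -rmorph_sum /=.
  rewrite (sum_enum_val
    (fun e => T (delta (enum_val j)) e * T (delta (enum_val k)) e)).
  rewrite isometry_dot // sum_delta /delta (inj_eq enum_val_inj).
  by case: eqP.
move=> psi; apply/matrixP => i j; rewrite !mxE.
under eq_bigr => k _ do rewrite !mxE -rmorphM.
rewrite -rmorph_sum; congr (_%:C).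
rewrite (sum_enum_val (fun e => T (delta e) (enum_val i) * psi e)).
have {2}-> : psi = fun e => \sum_y psi y * delta y e.
  apply/funext => e; rewrite -[LHS](sum_delta psi).
  by apply: eq_bigr => y _; rewrite /delta eq_sym mulrC.
by rewrite isometry_sum //; apply: eq_bigr => y _; rewrite mulrC.
Qed.

End RealVectors.

(** * Circuits and deferred measurements *)

Definition qreg (n : nat) : finType := (n.-tuple bool * bool)%type.

Definition phase (R : realType) (n : nat) (f : oracle n) (chi : qreg n -> R) :
    qreg n -> R :=
  fun z => (-1) ^+ (z.2 && f z.1) * chi z.

Section Reachable.
Variables (R : realType) (n : nat) (W : finType).
Local Notation E := (Defs.basis n W).
Implicit Types (Psi : oracle n -> E -> R).

(** Gates are indexed by all naturals, so that appending a query does not change the type of the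
    gate family. *)
Fixpoint grun (G : nat -> operator R n W) (psi0 : state R n W) (f : oracle n)
    (k : nat) : state R n W :=
  if k is k'.+1 then G k *m (oracle_op R W f *m grun G psi0 f k')
  else G 0%N *m psi0.

Definition reachable (t : nat) Psi : Prop :=
  exists psi0 G, [/\ sqnorm psi0 = 1, forall k, G k \is unitarymx &
    forall f, grun G psi0 f t = cvec (Psi f)].

Lemma eq_grun G G' psi0 f k :
  (forall i, (i <= k)%N -> G i = G' i) -> grun G psi0 f k = grun G' psi0 f k.
Proof.
elim: k => [|k IH] eqG /=; first by rewrite eqG.
by rewrite eqG // IH // => i le_ik; apply: eqG; exact: leqW.
Qed.

Lemma reachable_init (psi : E -> R) :
  norm2 psi = 1 -> reachable 0 (fun=> psi).
Proof.
move=> psi1; exists (cvec psi), (fun=> 1%:M); split=> [|k|f].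
- by rewrite sqnorm_cvec psi1.
- by apply/unitarymxP; rewrite mul1mx trmx1 map_mx1.
- by rewrite /= mul1mx.
Qed.

(** The gate is absorbed into the last one and so costs no query. *)
Lemma reachable_isometry t Psi T :
  isometry T -> reachable t Psi -> reachable t (fun f => T (Psi f)).
Proof.
move=> /isometry_unitary[A uA AE] [psi0 [G [psi1 uG GE]]].
exists psi0, (fun k => if k == t then A *m G k else G k); split=> [|k|f].
- exact: psi1.
- by case: eqP => [_|_]; [exact: mul_unitarymx | exact: uG].
rewrite -AE -GE; case: t GE => [|t] _ /=; first by rewrite -mulmxA.
rewrite eqxx -mulmxA.
congr (_ *m (_ *m (_ *m _))); apply: eq_grun => i le_it.
by rewrite ltn_eqF.
Qed.

Lemma oracle_op_cvec f (psi : E -> R) :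
  oracle_op R W f *m cvec psi =
  cvec (fun e : E => phase f (fun z => psi (z, e.2)) e.1).
Proof.
rewrite /oracle_op mul_diag_mx; apply/matrixP => k j; rewrite !mxE /phase /=.
case: (enum_val k) => [[x b] w] /=.
by rewrite rmorphM rmorphXn rmorphN1.
Qed.

Lemma reachable_query t Psi : reachable t Psi ->
  reachable t.+1 (fun f (e : E) => phase f (fun z => Psi f (z, e.2)) e.1).
Proof.
move=> [psi0 [G [psi1 uG GE]]].
exists psi0, (fun k => if k == t.+1 then 1%:M else G k); split=> [|k|f].
- exact: psi1.
- case: eqP => _; last exact: uG.
  by apply/unitarymxP; rewrite mul1mx trmx1 map_mx1.
rewrite /= eqxx mul1mx -oracle_op_cvec -GE; congr (_ *m _).
by apply: eq_grun => i le_it; rewrite ltn_eqF.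
Qed.

Lemma reachable_output t Psi (dec : W -> oracle n) : reachable t Psi ->
  exists A : query_algorithm R n t, forall f,
    output_prob A f f = (\sum_(e : E) Psi f e ^+ 2 * (dec e.2 == f)%:R)%:C.
Proof.
move=> [psi0 [G [psi1 uG GE]]].
pose P g : operator R n W := diag_mx (\row_k (dec (enum_val k).2 == g)%:R).
have P_complete : \sum_g (P g)^t* *m P g = 1%:M.
  apply/matrixP => j k; rewrite summxE.
  under eq_bigr => g _.
    rewrite /P tr_diag_mx map_diag_mx mulmx_diag !mxE rmorph_nat.
    rewrite -natrM mulnb andbb.
  over.
  rewrite mxE; case: (j =P k) => [->|_]; last first.
    by rewrite big1 // => g _; rewrite mulr0n.
  rewrite (bigD1 (dec (enum_val k).2)) //= eqxx big1 ?addr0 // => g.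
  by rewrite eq_sym => /negPf ->; rewrite mul0rn.
pose A := QueryAlgorithm psi1 (fun j : 'I_t.+1 => uG j) P_complete.
have runE f k : (k <= t)%N -> run A f k = grun G psi0 f k.
  by elim: k => [//|k IH] ltkt /=; rewrite inordK // IH // ltnW.
exists A => f; rewrite /output_prob runE // GE.
have -> : meas A f *m cvec (Psi f) =
    cvec (fun e : E => (dec e.2 == f)%:R * Psi f e).
  rewrite mul_diag_mx; apply/matrixP => k j; rewrite !mxE.
  by rewrite rmorphM rmorph_nat.
rewrite sqnorm_cvec; congr (_%:C); apply: eq_bigr => e _.
by rewrite exprMn mulrC -natrX; case: (_ == _).
Qed.

End Reachable.

(** [None] is a query; [Some u] is a gate on the query register that may depend on a classical
    state. *)
Definition local_program (R : realType) (n : nat) (St : Type) :=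
  seq (option (St -> (qreg n -> R) -> (qreg n -> R))).

Section LocalPrograms.
Variables (R : realType) (n : nat) (St : Type).
Local Notation Z := (qreg n).
Implicit Types (p : local_program R n St) (chi : Z -> R) (s : St).

Fixpoint leval (f : oracle n) s p chi : Z -> R :=
  if p is i :: p' then
    leval f s p' (if i is Some u then u s chi else phase f chi)
  else chi.

Definition queries p : nat := count (fun i => ~~ isSome i) p.

Fixpoint valid p : Prop :=
  if p is i :: p' then
    (if i is Some u then forall s, isometry (u s) else True) /\ valid p'
  else True.

Lemma valid_cat p p' : valid p -> valid p' -> valid (p ++ p').
Proof. by elim: p => //= i p IH [vi vp] vp'; split=> //; exact: IH. Qed.

Lemma leval_cat f s p p' chi :
  leval f s (p ++ p') chi = leval f s p' (leval f s p chi).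
Proof. by elim: p chi => //= i p IH chi; rewrite IH. Qed.

Lemma leval_scale f s p a chi : valid p ->
  leval f s p (fun z => a * chi z) = fun z => a * leval f s p chi z.
Proof.
elim: p chi => //= -[u|] p IH chi [vu vp]; rewrite -IH //.
  by rewrite isometry_scale.
by congr leval; apply/funext => z; rewrite /phase mulrCA.
Qed.

Lemma isometry_control (W : finType) (c : W -> St)
    (u : St -> (Z -> R) -> (Z -> R)) :
  (forall s, isometry (u s)) ->
  isometry (fun (psi : Defs.basis n W -> R) (e : Defs.basis n W) =>
    u (c e.2) (fun z => psi (z, e.2)) e.1).
Proof.
move=> isou; split=> [a psi phi e|psi]; first by rewrite (isou _).1.
have norm2E (F : Defs.basis n W -> R) :
    norm2 F = \sum_w norm2 (fun z => F (z, w)).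
  by rewrite /norm2 exchange_big pair_bigA; apply: eq_bigr => -[].
rewrite !norm2E; apply: eq_bigr => w _.
exact: ((isou (c w)).2 (fun z => psi (z, w))).
Qed.

Lemma reachable_program (W : finType) (c : W -> St) p t
    (Psi : oracle n -> Defs.basis n W -> R) :
  valid p -> reachable t Psi ->
  reachable (t + queries p) (fun f (e : Defs.basis n W) =>
    leval f (c e.2) p (fun z => Psi f (z, e.2)) e.1).
Proof.
elim: p t Psi => [|i p IH] t Psi.
  rewrite addn0 => _; congr reachable.
  by apply/funext => f; apply/funext => -[].
case: i => [u|] /= [vu vp] rPsi.
  exact: (IH _ _ vp (reachable_isometry (isometry_control c vu) rPsi)).
rewrite add1n addnS -addSn.
exact: (IH _ _ vp (reachable_query rPsi)).
Qed.

End LocalPrograms.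

(** * Simulation of adaptive measurements by a circuit *)

Section Adaptive.
Variables (R : realType) (n : nat) (St I : Type).
Local Notation Z := (qreg n).
Variables (prog : I -> local_program R n St) (next : I -> St -> Z -> St).
Variables (z0 : Z) (s0 : St) (dec : St -> oracle n).
Hypothesis prog_valid : forall i, valid (prog i).

Definition amplitude (f : oracle n) (i : I) (s : St) : Z -> R :=
  leval f s (prog i) (delta R z0).

(** The classical process to be simulated: each round starts a program in [z0], measures the
    register and updates the state by the outcome. *)
Fixpoint success (f : oracle n) (sched : seq I) (s : St) : R :=
  if sched is i :: sched' then
    \sum_z amplitude f i s z ^+ 2 * success f sched' (next i s z)
  else (dec s == f)%:R.

Variables (i0 : I) (sched : seq I).
Local Notation T := (size sched).
Local Notation W := {ffun 'I_T.+1 -> Z}.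

(** The classical state is not stored but recomputed from the outcomes in the first [r] slots. There
    is one slot more than rounds, since [inord] needs a successor. *)
Fixpoint control (r : nat) (w : W) : St :=
  if r is r'.+1 then next (nth i0 sched r') (control r' w) (w (inord r'))
  else s0.

Definition upd (w : W) (r : 'I_T.+1) (z : Z) : W :=
  [ffun i => if i == r then z else w i].

(** The swap records the outcome in slot [r] and, as this slot still holds [z0], resets the register
    for the next round. *)
Definition swap_slot (r : 'I_T.+1) (e : Defs.basis n W) : Defs.basis n W :=
  (e.2 r, upd e.2 r e.1).

Lemma swap_slotK r : involutive (swap_slot r).
Proof.
case=> z w; congr pair => /=; first by rewrite ffunE eqxx.
by apply/ffunP => i; rewrite !ffunE; case: eqP => [->|].
Qed.

Lemma isometry_swap r :
  isometry (fun (psi : Defs.basis n W -> R) e => psi (swap_slot r e)).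
Proof.
split=> // psi; rewrite /norm2 [RHS](reindex (swap_slot r)) //.
exact/onW_bij/inv_bij/swap_slotK.
Qed.

Lemma control_upd r w (k : 'I_T.+1) z :
  (r <= k)%N -> control r (upd w k z) = control r w.
Proof.
elim: r => //= r IH lt_rk; rewrite IH ?ffunE; last exact: ltnW.
rewrite -val_eqE /= inordK ?ltn_eqF //.
exact: (ltn_trans lt_rk).
Qed.

(** The invariant: the register and the slots of later rounds are blank, and the success still to
    come, averaged over the recorded branches, equals the total success. *)
Lemma reachable_rounds r : (r <= T)%N ->
  exists2 Psi : oracle n -> Defs.basis n W -> R,
    reachable (\sum_(i <- take r sched) queries (prog i)) Psi &
    forall f,
      (forall e, Psi f e != 0 ->
         e.1 = z0 /\ forall i : 'I_T.+1, (r <= i)%N -> e.2 i = z0) /\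
      \sum_e Psi f e ^+ 2 * success f (drop r sched) (control r e.2)
        = success f sched s0.
Proof.
elim: r => [_|r IH ltrT].
  pose y0 : Defs.basis n W := (z0, [ffun=> z0]).
  exists (fun=> delta R y0).
    by rewrite take0 big_nil; apply: reachable_init; exact: norm2_delta.
  move=> f; split=> [e|].
    rewrite /delta; case: (e =P y0) => [->|]; last by rewrite eqxx.
    by move=> _; split=> // i _; rewrite ffunE.
  under eq_bigr do rewrite expr2 -mulrA.
  by rewrite sum_delta /delta eqxx mul1r drop0.
have [Psi rPsi PsiP] := IH (ltnW ltrT).
pose i := nth i0 sched r; pose k : 'I_T.+1 := inord r.
have kE : k = r :> nat by rewrite inordK // ltnS ltnW.
pose Phi f (e : Defs.basis n W) : R :=
  leval f (control r e.2) (prog i) (fun z => Psi f (z, e.2)) e.1.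
(* The register is blank before the round, so the branch [w] is a multiple of [delta R z0], and
   programs are linear. *)
have PhiE f z w : Phi f (z, w) = Psi f (z0, w) * amplitude f i (control r w) z.
  rewrite /Phi /= /amplitude -[RHS]/((fun z => _) z) -leval_scale //.
  congr (leval _ _ _ _ z); apply/funext => z'; rewrite /delta.
  case: eqP => [->|nz]; rewrite ?mulr1 // mulr0; apply/eqP/negPn/negP.
  by move=> /(proj1 (PsiP f))[].
exists (fun f e => Phi f (swap_slot k e)).
  rewrite (take_nth i0) // big_rcons /=.
  apply: (reachable_isometry (Psi := Phi) (isometry_swap k)).
  exact: (reachable_program (control r) (prog_valid i) rPsi).
move=> f; have [supp sumE] := PsiP f; split=> [[z w]|].
  rewrite /swap_slot /= PhiE mulf_eq0 negb_or => /andP[/supp[_ /= wz0] _].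
  split=> [|j ltrj]; first last.
    by have := wz0 j (ltnW ltrj); rewrite ffunE -val_eqE /= kE gtn_eqF.
  by have := wz0 k (eq_leq (esym kE)); rewrite ffunE eqxx.
rewrite (reindex (swap_slot k)) /=; last exact/onW_bij/inv_bij/swap_slotK.
have sumZW (F : Defs.basis n W -> R) : \sum_e F e = \sum_w \sum_z F (z, w).
  by rewrite exchange_big pair_bigA; apply: eq_bigr => -[].
rewrite -sumE !sumZW; apply: eq_bigr => w _.
rewrite [RHS](bigD1 z0) //= [X in _ + X]big1 ?addr0; last first.
  move=> z /negPf nz.
  rewrite (_ : Psi f (z, w) = 0) ?expr0n ?mul0r //.
  by apply/eqP/negPn/negP => /supp[] /eqP /=; rewrite nz.
rewrite (drop_nth i0 ltrT) /= mulr_sumr; apply: eq_bigr => z _.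
rewrite -/k swap_slotK PhiE exprMn -mulrA control_upd ?kE // ffunE eqxx.
by [].
Qed.

Theorem adaptive_algorithm :
  exists A : query_algorithm R n (\sum_(i <- sched) queries (prog i)),
    forall f, output_prob A f f = (success f sched s0)%:C.
Proof.
have [Psi rPsi PsiP] := reachable_rounds (leqnn T).
rewrite take_size in rPsi.
have [A AE] := reachable_output (dec \o control T) rPsi.
by exists A => f; rewrite AE -(proj2 (PsiP f)) drop_size.
Qed.

End Adaptive.

(** * Grover search *)

Section LocalIsometries.
Variables (R : realType) (n : nat).
Local Notation Z := (qreg n).

Lemma isometry_comp (E : finType) (T U : (E -> R) -> (E -> R)) :
  isometry T -> isometry U -> isometry (T \o U).
Proof.
move=> [linT nT] [linU nU]; split=> [a psi phi e|psi] /=; last by rewrite nT.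
by rewrite -linT; congr (T _ e); apply/funext => e'; rewrite linU.
Qed.

Definition sign_flip (E : finType) (c : E -> bool) (psi : E -> R) : E -> R :=
  fun e => (-1) ^+ c e * psi e.

Lemma isometry_sign_flip (E : finType) (c : E -> bool) :
  isometry (sign_flip c).
Proof.
split=> [a psi phi e|psi]; rewrite /sign_flip; first by ring.
by apply: eq_bigr => e _; rewrite exprMn sqrr_sign mul1r.
Qed.

(* For [v = 0] the junk value [2 / 0 = 0] makes this the identity. *)
Definition householder (E : finType) (v psi : E -> R) : E -> R :=
  fun e => psi e - 2 / norm2 v * (\sum_y v y * psi y) * v e.

Lemma norm2_eq0 (E : finType) (v : E -> R) : norm2 v = 0 -> forall e, v e = 0.
Proof.
move=> /eqP; rewrite psumr_eq0 => [/allP v0 e|e _]; last exact: sqr_ge0.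
by have := v0 e (mem_index_enum _); rewrite sqrf_eq0 => /eqP.
Qed.

Lemma isometry_householder (E : finType) (v : E -> R) :
  isometry (householder v).
Proof.
split=> [a psi phi e|psi]; rewrite /householder.
  have -> : \sum_y v y * (a * psi y + phi y) =
      a * (\sum_y v y * psi y) + \sum_y v y * phi y.
    by rewrite mulr_sumr -big_split; apply: eq_bigr => y _; rewrite /=; ring.
  by ring.
set S := \sum_y _; set c := 2 / norm2 v.
have expand (k : R) : norm2 (fun e => psi e - k * v e) =
    norm2 psi - 2 * k * S + k ^+ 2 * norm2 v.
  rewrite /S /norm2 !mulr_sumr -sumrN -!big_split /=.
  by apply: eq_bigr => e _; ring.
rewrite expand.
have [v0|v0] := eqVneq (norm2 v) 0; rewrite /c.
  by rewrite v0 invr0; ring.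
by field.
Qed.

(** The reflection in the hyperplane orthogonal to [a - b] exchanges the unit vectors [a] and
    [b]. *)
Lemma householder_map (E : finType) (a b : E -> R) :
  norm2 a = 1 -> norm2 b = 1 -> householder (fun e => a e - b e) a = b.
Proof.
move=> a1 b1; set v := fun e => a e - b e; set c := \sum_e a e * b e.
have vn : norm2 v = 2 * (1 - c).
  have -> : norm2 v = norm2 a + norm2 b - 2 * c.
    rewrite /norm2 /c mulr_sumr -sumrN -!big_split /=.
    by apply: eq_bigr => e _; rewrite /v; ring.
  by rewrite a1 b1; ring.
have va : \sum_e v e * a e = 1 - c.
  rewrite -a1 /norm2 /c -sumrN -big_split /=.
  by apply: eq_bigr => e _; rewrite /v; ring.
apply/funext => e; rewrite /householder va vn.
(* Here [norm2 v = 0], so [a = b] and the reflection is the identity. *)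
have [c1|c1] := eqVneq (1 - c) 0.
  move: vn; rewrite c1 mulr0 => /norm2_eq0 /(_ e); rewrite /v => ve.
  by rewrite ve mulr0 subr0; apply/eqP; rewrite -subr_eq0 ve.
by rewrite /v; field.
Qed.

Lemma sum_qreg (F : Z -> R) :
  \sum_z F z = \sum_x (F (x, true) + F (x, false)).
Proof.
transitivity (\sum_x \sum_b F (x, b)).
  by rewrite pair_bigA; apply: eq_bigr => -[].
by apply: eq_bigr => x _; rewrite big_bool.
Qed.

Definition hadamard (psi : Z -> R) : Z -> R :=
  fun z => (psi (z.1, false) + (-1) ^+ z.2 * psi (z.1, true)) / Num.sqrt 2.

Lemma isometry_hadamard : isometry hadamard.
Proof.
split=> [a psi phi z|psi]; rewrite /hadamard; first by ring.
rewrite /norm2 !sum_qreg; apply: eq_bigr => x _ /=.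
by rewrite !exprMn exprVn sqr_sqrtr // expr1 expr0; field.
Qed.

Lemma isometry_phase (f : oracle n) : isometry (@phase R n f).
Proof. exact: isometry_sign_flip. Qed.

Lemma norm2_leval (St : Type) (p : local_program R n St) f s chi :
  valid p -> norm2 (leval f s p chi) = norm2 chi.
Proof.
elim: p chi => //= -[u|] p IH chi [vu vp]; rewrite IH //; first exact: (vu s).2.
exact: (isometry_phase f).2.
Qed.

End LocalIsometries.

(** * Grover iterations as rotations of a plane *)

Section Grover.
Variables (R : realType) (n : nat) (St : Type).
Local Notation X := (n.-tuple bool).
Local Notation Z := (qreg n).
Variables (dom : St -> {set X}) (guess : St -> X -> bool) (z0 : Z).

(** The query bit is set, so that a query acts as the phase [(-1) ^+ f x]. *)
Definition uniform (s : St) : Z -> R :=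
  fun z => (z.2 && (z.1 \in dom s))%:R / Num.sqrt #|dom s|%:R.

Definition prepare (s : St) : (Z -> R) -> (Z -> R) :=
  householder (fun z => delta R z0 z - uniform s z).

(** On states with the query bit set, a query and this sign flip negate the unmarked inputs. This
    and the reflection are both the negatives of the usual Grover factors, so the signs cancel. *)
Definition diffuse (s : St) : (Z -> R) -> (Z -> R) :=
  householder (uniform s) \o sign_flip (fun z => ~~ guess s z.1).

Definition iterations (j : nat) : local_program R n St :=
  flatten (nseq j [:: None; Some diffuse]).

(* The two Hadamard gates around the last query write [~~ f x] into the
   query bit. *)
Definition grover (j : nat) : local_program R n St :=
  Some prepare :: iterations j ++
    [:: Some (fun=> @hadamard R n); None; Some (fun=> @hadamard R n)].

Lemma valid_iterations j : valid (iterations j).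
Proof.
elim: j => //= j IH; split=> //; split=> // s.
apply: isometry_comp; first exact: isometry_householder.
exact: isometry_sign_flip.
Qed.

Lemma valid_grover j : valid (grover j).
Proof.
split=> [s|]; first exact: isometry_householder.
apply: valid_cat; first exact: valid_iterations.
have isoH (s : St) := isometry_hadamard R n.
exact: (conj isoH (conj I (conj isoH I))).
Qed.

Lemma queries_grover j : queries (grover j) = j.+1.
Proof.
rewrite /queries /= add0n count_cat /= addn1; congr _.+1.
by elim: j => //= j ->.
Qed.

Variables (f : oracle n) (s : St).
Hypothesis dom_gt0 : (0 < #|dom s|)%N.
Local Notation D := (dom s).
Local Notation marked x := (f x != guess s x).

Lemma norm2_uniform : norm2 (uniform s) = 1.
Proof.
have D0 : #|D|%:R != 0 :> R by rewrite pnatr_eq0 -lt0n.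
rewrite /norm2 sum_qreg /uniform /=.
under eq_bigr => x _.
  rewrite !exprMn exprVn sqr_sqrtr // expr0n mul0r addr0 -natrX.
over.
rewrite -mulr_suml -natr_sum.
suff -> : (\sum_x (x \in D) ^ 2)%N = #|D| by rewrite divff.
rewrite -sum1_card [RHS]big_mkcond /=.
by apply: eq_bigr => x _; case: (x \in D).
Qed.

Lemma prepareE : prepare s (delta R z0) = uniform s.
Proof.
apply: householder_map; last exact: norm2_uniform.
exact: norm2_delta.
Qed.

Definition on_true (g : X -> R) : Z -> R := fun z => if z.2 then g z.1 else 0.

Lemma readout g : leval f s [:: Some (fun=> @hadamard R n); None;
    Some (fun=> @hadamard R n)] (on_true g) =
  fun z => (z.2 == ~~ f z.1)%:R * g z.1.
Proof.
have rr : (Num.sqrt (2 : R))^-1 * (Num.sqrt 2)^-1 = 2^-1.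
  by rewrite -invfM -expr2 sqr_sqrtr.
apply/funext => -[x b] /=; rewrite /hadamard /phase /on_true /=.
transitivity ((Num.sqrt (2 : R))^-1 * (Num.sqrt 2)^-1 *
    ((1 - (-1) ^+ b * (-1) ^+ f x) * g x)).
  by rewrite expr0 expr1; ring.
by rewrite rr; case: b (f x) => -[] /=; rewrite ?expr0 ?expr1; field.
Qed.

Lemma leval_grover j chi : leval f s (grover j) chi =
  leval f s [:: Some (fun=> @hadamard R n); None; Some (fun=> @hadamard R n)]
    (leval f s (iterations j) (prepare s chi)).
Proof. by rewrite /= leval_cat. Qed.

Lemma iteration_on_true g : diffuse s (phase f (on_true g)) =
  on_true (fun x =>
    (-1) ^+ (f x == guess s x) * g x -
    2 * (\sum_y (y \in D)%:R * ((-1) ^+ (f y == guess s y) * g y)) / #|D|%:R *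
      (x \in D)%:R).
Proof.
have D0 : Num.sqrt (#|D|%:R : R) != 0 by rewrite sqrtr_eq0 -ltNge ltr0n.
have sgn x : (-1) ^+ (~~ guess s x) * (-1) ^+ f x
    = (-1) ^+ (f x == guess s x) :> R.
  by rewrite -signr_addb; case: (guess s x) (f x) => -[].
rewrite /diffuse /= /householder norm2_uniform sum_qreg.
set flipped := sign_flip _ _.
have -> : \sum_x (uniform s (x, true) * flipped (x, true) +
      uniform s (x, false) * flipped (x, false))
    = (\sum_y (y \in D)%:R * ((-1) ^+ (f y == guess s y) * g y)) /
      Num.sqrt #|D|%:R.
  rewrite mulr_suml; apply: eq_bigr => x _.
  by rewrite /flipped /sign_flip /phase /uniform /on_true /= -sgn; field.
apply/funext => -[x []];
  rewrite /flipped /sign_flip /phase /uniform /on_true /=.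
  rewrite -sgn -[in RHS](sqr_sqrtr (ler0n R #|D|)); field.
  by [].
by rewrite mulr0n !mulr0 mul0r mulr0 subr0.
Qed.

Lemma iterations_on_true j g :
  exists g', leval f s (iterations j) (on_true g) = on_true g'.
Proof.
elim: j g => [|j IH] g; first by exists g.
by rewrite /= iteration_on_true; exact: IH.
Qed.

Lemma uniform_on_true :
  uniform s = on_true (fun x => (x \in D)%:R / Num.sqrt #|D|%:R).
Proof.
by apply/funext => -[x []]; rewrite /uniform /on_true //= mul0r.
Qed.

(** The final query certifies the outcome: a measured pair [(x, b)] has [b = ~~ f x] even if the
    search misses. Hence no outcome ever eliminates the true oracle. *)
Lemma grover_outcome j z : z.2 = f z.1 ->
  leval f s (grover j) (delta R z0) z = 0.
Proof.
rewrite leval_grover prepareE uniform_on_true.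
set g0 := (X in on_true X); have [g ->] := iterations_on_true j g0.
by rewrite readout => ->; case: (f z.1); rewrite mul0r.
Qed.

Definition hit : pred X := fun x => (x \in D) && marked x.
Definition miss : pred X := fun x => (x \in D) && ~~ marked x.

Lemma sum_indicator (A : pred X) : \sum_x (A x)%:R = #|A|%:R :> R.
Proof. by rewrite -natr_sum -sum1_card [in RHS]big_mkcond. Qed.

Lemma card_hit_miss : (#|hit| + #|miss| = #|D|)%N.
Proof.
rewrite -(cardID [pred x | marked x] (mem D)).
by congr addn; apply: eq_card => x; rewrite [LHS]unfold_in !inE // andbC.
Qed.

(* The plane spanned by the uniform superpositions of hits and misses is
   invariant; one iteration rotates it by twice the angle [theta]. *)
Definition plane (alpha : R) : Z -> R :=
  on_true (fun x => (hit x)%:R * (sin alpha / Num.sqrt #|hit|%:R)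
                  + (miss x)%:R * (cos alpha / Num.sqrt #|miss|%:R)).

Variable theta : R.
Hypothesis hit_gt0 : (0 < #|hit|)%N.
Hypothesis sin_theta : sin theta = Num.sqrt #|hit|%:R / Num.sqrt #|D|%:R.
Hypothesis cos_theta : cos theta = Num.sqrt #|miss|%:R / Num.sqrt #|D|%:R.

Lemma uniform_plane : uniform s = plane theta.
Proof.
have h0 : Num.sqrt (#|hit|%:R : R) != 0 by rewrite sqrtr_eq0 -ltNge ltr0n.
have D0 : Num.sqrt (#|D|%:R : R) != 0 by rewrite sqrtr_eq0 -ltNge ltr0n.
rewrite uniform_on_true /plane; congr on_true; apply/funext => x.
have simpl_div (y : R) :
    y != 0 -> y / Num.sqrt #|D|%:R / y = (Num.sqrt #|D|%:R)^-1.
  by move=> y0; rewrite mulrAC divff // mul1r.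
rewrite sin_theta cos_theta simpl_div //.
(* Without misses the square root of their number is 0 and cannot be cancelled; the cancellation is
   only needed at a miss. *)
have [m0|m0] := boolP (miss x).
  have m1 : Num.sqrt (#|miss|%:R : R) != 0.
    by rewrite sqrtr_eq0 -ltNge ltr0n; apply/card_gt0P; exists x.
  rewrite simpl_div // -mulrDl -natrD; congr (_%:R * _).
  by move: m0; rewrite /miss /hit; case: (x \in D); case: (marked x).
rewrite mul0r addr0; congr (_%:R * _).
by move: m0; rewrite /miss /hit; case: (x \in D); case: (marked x).
Qed.

Lemma iteration_plane alpha :
  diffuse s (phase f (plane alpha)) = plane (alpha + theta *+ 2).
Proof.
have h0 : Num.sqrt (#|hit|%:R : R) != 0 by rewrite sqrtr_eq0 -ltNge ltr0n.
have D0 : Num.sqrt (#|D|%:R : R) != 0 by rewrite sqrtr_eq0 -ltNge ltr0n.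
have hh := sqr_sqrtr (ler0n R #|hit|).
have mm := sqr_sqrtr (ler0n R #|miss|).
have DD := sqr_sqrtr (ler0n R #|D|).
rewrite iteration_on_true /plane; congr on_true; apply/funext => x.
set a := sin alpha / _; set c := cos alpha / _.
have -> : \sum_y (y \in D)%:R * ((-1) ^+ (f y == guess s y) *
      ((hit y)%:R * a + (miss y)%:R * c)) = #|hit|%:R * a - #|miss|%:R * c.
  rewrite -!sum_indicator !mulr_suml -sumrB; apply: eq_bigr => y _.
  rewrite /hit /miss; case: (y \in D); case: (f y == guess s y) => /=;
    by rewrite ?expr0 ?expr1; ring.
have ha : #|hit|%:R * a = Num.sqrt #|hit|%:R * sin alpha.
  by rewrite /a -{1}hh; field.
have mc : #|miss|%:R * c = Num.sqrt #|miss|%:R * cos alpha.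
  (* Without misses, [c] is a division by 0 and both sides vanish. *)
  rewrite /c -{1}mm; have [->|m1] := eqVneq (Num.sqrt (#|miss|%:R : R)) 0.
    by rewrite expr0n !mul0r.
  by field.
rewrite ha mc.
have cosE : Num.sqrt #|miss|%:R = cos theta * Num.sqrt #|D|%:R.
  by rewrite cos_theta divfK.
have sinE : Num.sqrt #|hit|%:R = sin theta * Num.sqrt #|D|%:R.
  by rewrite sin_theta divfK.
have s0 : sin theta != 0.
  by apply: contraNneq h0 => st; rewrite sinE st mul0r.
have cos2 : cos (alpha + theta *+ 2) =
    cos alpha * (2 * cos theta ^+ 2 - 1) -
    2 * sin alpha * sin theta * cos theta.
  by rewrite cosD cos_mulr2n sin_mulr2n; ring.
have sin2 : sin (alpha + theta *+ 2) =
    sin alpha * (1 - 2 * sin theta ^+ 2) +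
    2 * cos alpha * sin theta * cos theta.
  by rewrite sinD cos_mulr2n sin_mulr2n cos2sin2; ring.
set r := Num.sqrt (#|D|%:R : R) in D0 DD cosE sinE *.
rewrite cos2 sin2 /a /c cosE sinE -DD.
have [mx|mx] := boolP (miss x).
  have c0 : cos theta != 0.
    have : Num.sqrt (#|miss|%:R : R) != 0.
      by rewrite sqrtr_eq0 -ltNge ltr0n; apply/card_gt0P; exists x.
    by apply: contraNneq => ct; rewrite cosE ct mul0r.
  have -> : hit x = false.
    by move: mx; rewrite /miss /hit; case: (x \in D); case: (marked x).
  have -> : x \in D by case/andP: mx.
  have -> : f x == guess s x by move: mx; rewrite /miss negbK => /andP[].
  by rewrite expr1 !mul0r !add0r /=; field; rewrite c0 D0.
have [hx|hx] := boolP (hit x).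
  have /andP[-> /negPf ->] := hx.
  by rewrite expr0 !mul0r !addr0 /=; field; rewrite s0 D0.
have -> : (x \in D) = false.
  by move: mx hx; rewrite /miss /hit; case: (x \in D); case: (marked x).
by rewrite !mul0r !addr0 !mulr0 subr0.
Qed.

Lemma iterations_plane j alpha :
  leval f s (iterations j) (plane alpha) = plane (alpha + theta *+ j.*2).
Proof.
elim: j alpha => [|j IH] alpha; first by rewrite addr0.
by rewrite /= iteration_plane IH -addrA -mulrnDr.
Qed.

(** The uniform state has angle [theta], and [j] iterations add [2 * j * theta]. *)
Lemma grover_success j :
  \sum_(z | hit z.1) leval f s (grover j) (delta R z0) z ^+ 2
  = sin (theta *+ j.*2.+1) ^+ 2.
Proof.
have h0 : Num.sqrt (#|hit|%:R : R) != 0 by rewrite sqrtr_eq0 -ltNge ltr0n.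
rewrite leval_grover prepareE uniform_plane iterations_plane -mulrS.
rewrite /plane readout big_mkcond sum_qreg /=.
transitivity (\sum_x (hit x)%:R *
    (sin (theta *+ j.*2.+1) / Num.sqrt #|hit|%:R) ^+ 2).
  apply: eq_bigr => x _; case: ifPn => [hx|]; last by rewrite mul0r addr0.
  have -> : miss x = false.
    by move: hx; rewrite /miss /hit; case: (x \in D); case: (marked x).
  by rewrite hx; case: (f x); rewrite /= !(mul0r, mul1r, addr0, add0r, expr0n).
rewrite -mulr_suml sum_indicator exprMn exprVn sqr_sqrtr //.
by rewrite mulrC divfK // pnatr_eq0 -lt0n.
Qed.

End Grover.

(** * Amplification with an unknown number of solutions *)

Section Tripling.
Variable R : realType.
Implicit Type theta : R.

Lemma sin_mulr3n theta :
  sin (theta *+ 3) = sin theta * (3 - 4 * sin theta ^+ 2).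
Proof.
rewrite mulrS sinD cos_mulr2n sin_mulr2n.
transitivity (sin theta * (4 * cos theta ^+ 2 - 1)); first by ring.
by rewrite cos2sin2; ring.
Qed.

(* While [s = sin (3 ^ k * theta)] stays below 1/2, the quantity [s + s ^ 3] at
   least triples at each step: for [s' = s * (3 - 4 * s ^ 2)], the inequality
   [s' + s' ^ 3 >= 3 * (s + s ^ 3)] reads [(3 - 4 * s ^ 2) ^ 3 >= 7]. *)
Lemma sin_tripling theta L : 0 < sin theta ->
  (forall k, (k <= L)%N -> sin (theta *+ 3 ^ k) < 1 / 2) ->
  3 ^+ L * sin theta < 5 / 8.
Proof.
move=> s_gt0 small.
have [sL_gt0 phiL] : 0 < sin (theta *+ 3 ^ L) /\
    3 ^+ L * sin theta <= sin (theta *+ 3 ^ L) + sin (theta *+ 3 ^ L) ^+ 3.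
  elim: L small => [|L IH] small.
    rewrite expn0 expr0 mul1r mulr1n; split=> //.
    by rewrite lerDl exprn_ge0 // ltW.
  have [|sL_gt0 phiL] := IH; first by move=> k le_kL; apply: small; exact: leqW.
  have := small L (leqnSn L).
  rewrite expnSr mulrnA sin_mulr3n (exprS 3) -mulrA.
  move: phiL sL_gt0; set s := sin (theta *+ 3 ^ L); set p := 3 ^+ L * _.
  move=> phiL sL_gt0 s_lt.
  have s2 : s ^+ 2 < 1 / 4 by nra.
  have q2 : 2 < 3 - 4 * s ^+ 2 by lra.
  split; first by rewrite mulr_gt0 //; lra.
  have q8 : 7 <= (3 - 4 * s ^+ 2) ^+ 3.
    move: q2; set q := 3 - _ => q2; nra.
  rewrite exprMn; have : 7 * s ^+ 3 <= s ^+ 3 * (3 - 4 * s ^+ 2) ^+ 3.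
    by rewrite mulrC ler_wpM2l // exprn_ge0 // ltW.
  have -> : s * (3 - 4 * s ^+ 2) = 3 * s - 4 * s ^+ 3 by ring.
  lra.
have := small L (leqnn L); move: sL_gt0 phiL.
set s := sin (theta *+ 3 ^ L) => s_gt0' phiL s_lt.
apply: (le_lt_trans phiL).
have -> : s + s ^+ 3 = s * (1 + s * s) by ring.
by nra.
Qed.

(** With [(3 ^ k).-1./2] iterations the final angle is exactly [3 ^ k * theta]. *)
Lemma odd_half_pow3 k : ((3 ^ k).-1./2).*2.+1 = (3 ^ k)%N.
Proof.
have odd3 : odd (3 ^ k) by rewrite oddX orbT.
by case: (3 ^ k)%N odd3 => //= m /even_halfK ->.
Qed.

(** If every [k] failed, [sin_tripling] would give [3 ^ L * sin theta < 5 / 8]. But one hit among at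
    most [9 ^ L] inputs already gives [3 ^ L * sin theta >= 1]. *)
Lemma grover_amplification (n : nat) (St : Type)
    (dom : St -> {set n.-tuple bool}) (guess : St -> n.-tuple bool -> bool)
    (z0 : qreg n) (f : oracle n) (s : St) (L : nat) :
  (#|dom s| <= 9 ^ L)%N -> (0 < #|hit dom guess f s|)%N ->
  exists2 k, (k <= L)%N &
    1 / 4 <= \sum_(z | hit dom guess f s z.1)
      leval f s (grover R dom guess z0 ((3 ^ k).-1./2)) (delta R z0) z ^+ 2.
Proof.
move=> domL hit_gt0; set d : R := #|dom s|%:R.
have dE := card_hit_miss dom guess f s.
have dom_gt0 : (0 < #|dom s|)%N by rewrite -dE addn_gt0 hit_gt0.
have d_gt0 : 0 < d by rewrite ltr0n.
pose x : R := Num.sqrt #|hit dom guess f s|%:R / Num.sqrt d.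
have x2 : x ^+ 2 = #|hit dom guess f s|%:R / d.
  by rewrite exprMn exprVn !sqr_sqrtr // ltW.
have x_gt0 : 0 < x by rewrite divr_gt0 ?sqrtr_gt0 ?ltr0n.
have x_le1 : x <= 1.
  rewrite -[_ <= 1](ler_pXn2r (n := 2)) ?nnegrE ?ler01 ?(ltW x_gt0) //.
  by rewrite expr1n x2 ler_pdivrMr // mul1r ler_nat -dE leq_addr.
pose theta := asin x.
have x_int : -1 <= x <= 1 by rewrite x_le1 andbT; lra.
have sinE : sin theta = x by rewrite /theta asinK.
have cosE : cos theta = Num.sqrt #|miss dom guess f s|%:R / Num.sqrt d.
  rewrite /theta cos_asin // x2 -sqrtrV ?(ltW d_gt0) // -sqrtrM //.
  congr Num.sqrt; apply: (mulIf (lt0r_neq0 d_gt0)).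
  rewrite mulrBl mul1r !divfK ?lt0r_neq0 //.
  by rewrite /d -dE natrD; ring.
have successE j := grover_success z0 dom_gt0 hit_gt0 sinE cosE j.
apply: contrapT => noK.
have small k : (k <= L)%N -> sin (theta *+ 3 ^ k) < 1 / 2.
  move=> le_kL; rewrite ltNge; apply/negP => big; apply: noK; exists k => //.
  by rewrite successE odd_half_pow3; nra.
have := sin_tripling _ small; rewrite sinE => /(_ x_gt0).
apply/negP; rewrite -leNgt.
suff : 1 <= 3 ^+ L * x by lra.
rewrite -[1 <= _](ler_pXn2r (n := 2)) ?nnegrE ?ler01 //; last first.
  by rewrite mulr_ge0 ?exprn_ge0 // ltW.
rewrite expr1n exprMn x2 mulrA ler_pdivlMr // mul1r -exprM mulnC exprM.
rewrite (_ : 3 ^+ 2 = 9%:R); last by ring.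
rewrite -natrX -natrM ler_nat (leq_trans domL) // leq_pmulr //.
Qed.

End Tripling.

(** * Halving *)

Section Halving.
Variables (R : realType) (n K L : nat).
Local Notation X := (n.-tuple bool).
Local Notation Z := (qreg n).
Variable blk : X -> 'I_K.
Hypothesis blk_le : forall j, (#|[set x | blk x == j]%SET| <= 9 ^ L)%N.
Implicit Types (C F : {set oracle n}) (f g : oracle n) (x : X).

Definition x0 : X := [tuple false | _ < n].
Definition z0 : Z := (x0, false).

(** A tie counts as [true]. *)
Definition majority C x : bool := (#|C| <= 2 * #|[set g in C | g x]%SET|)%N.

Definition split_at C x : bool :=
  [exists g in C, [exists g' in C, g x != g' x]].

Definition witness C : X := odflt x0 [pick x | split_at C x].

(* A state [(C, F)] consists of the candidates [C] at the beginning of the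
   current stage and of those among them that agree with all the answers
   obtained during this stage. *)
Definition candidates : Type := ({set oracle n} * {set oracle n})%type.

Definition dom (s : candidates) : {set X} :=
  [set x | blk x == blk (witness s.1)]%SET.

Definition guess (s : candidates) : X -> bool := majority s.1.

Definition agree C : {set oracle n} :=
  [set g in C | [forall x in dom (C, C), g x == majority C x]]%SET.

(** If the answers did not halve the candidates, the block is presumed to contain no deviation from
    the majority. *)
Definition commit (s : candidates) : {set oracle n} :=
  if (2 * #|s.2| <= #|s.1|)%N then s.2 else agree s.1.

(* [Some k] is a Grover search with [(3 ^ k - 1) / 2] iterations, and [None]
   ends a stage. *)
Definition prog (i : option nat) : local_program R n candidates :=
  if i is Some k then grover R dom guess z0 ((3 ^ k).-1./2) else [::].

Definition next (i : option nat) (s : candidates) (z : Z) : candidates :=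
  if i is Some _ then (s.1, [set g in s.2 | g z.1 == ~~ z.2]%SET)
  else (commit s, commit s).

Definition dec (s : candidates) : oracle n :=
  odflt [ffun=> false] [pick g in s.1].

Definition searches (rho : nat) : seq nat :=
  flatten (nseq rho (iota 0 L.+1)).

Definition stage (rho : nat) : seq (option nat) :=
  rcons (map Some (searches rho)) None.

Definition stages (rho T : nat) : seq (option nat) :=
  flatten (nseq T (stage rho)).

Lemma prog_valid i : valid (prog i).
Proof. by case: i => [k|] //; exact: valid_grover. Qed.

Local Notation amp := (amplitude prog z0).
Local Notation success := (success prog next z0 dec).

Lemma dom_gt0 s : (0 < #|dom s|)%N.
Proof. by apply/card_gt0P; exists (witness s.1); rewrite inE. Qed.

Lemma success_ge0 f sched s : 0 <= success f sched s.
Proof.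
elim: sched s => [|i sched IH] s /=; first exact: ler0n.
by apply: sumr_ge0 => z _; rewrite mulr_ge0 // sqr_ge0.
Qed.

(** The condition under which ending the stage with [commit] keeps [f]. *)
Definition good f C F : bool :=
  (f \in F) && ((2 * #|F| <= #|C|)%N || (#|hit dom guess f (C, C)| == 0)%N).

Lemma majority_halves C f x : f x != majority C x ->
  (2 * #|[set g in C | g x == f x]%SET| <= #|C|)%N.
Proof.
rewrite /majority.
have : (#|[set g in C | g x]%SET| + #|[set g in C | ~~ g x]%SET| = #|C|)%N.
  rewrite -(cardsID [set g : oracle n | g x]%SET C).
  by congr addn; apply: eq_card => g; rewrite !inE // andbC.
have -> : #|[set g in C | g x == f x]%SET| =
    if f x then #|[set g in C | g x]%SET| else #|[set g in C | ~~ g x]%SET|.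
  by case: (f x); apply: eq_card => g; rewrite !inE; case: (g x).
by case: (f x) => /=; lia.
Qed.

(** A certified deviation halves the candidates, as at most half of [C] takes the minority value;
    later answers only shrink [F]. *)
Lemma good_next f C F k z : F \subset C -> f \in F ->
  f z.1 = ~~ z.2 -> good f C F || hit dom guess f (C, C) z.1 ->
  good f C (next (Some k) (C, F) z).2.
Proof.
move=> sFC fF fz gh; rewrite /good /= inE fF fz eqxx /=.
set F' := [set g in F | _]%SET.
have sF' : F' \subset F by apply/fintype.subsetP => g; rewrite inE => /andP[].
case/orP: gh => [/andP[_ /orP[le_F|no_hit]]|/andP[_ mz]].
- by rewrite (leq_trans _ le_F) // leq_mul2l subset_leq_card.
- by rewrite no_hit orbT.
rewrite (leq_trans _ (majority_halves mz)) // leq_mul2l subset_leq_card //.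
apply/fintype.subsetP => g; rewrite !inE fz => /andP[gF ->].
by rewrite (fintype.subsetP sFC _ gF).
Qed.

Lemma norm2_amplitude f i s : \sum_z amp f i s z ^+ 2 = 1.
Proof.
rewrite -[LHS]/(norm2 _) /amplitude norm2_leval; last exact: prog_valid.
exact: norm2_delta.
Qed.

(** The gates read only the candidates at the start of the stage, so hit probabilities stay fixed
    while [F] shrinks. *)
Lemma amplitude_fst f k C F : amp f (Some k) (C, F) = amp f (Some k) (C, C).
Proof.
rewrite /amplitude -[prog (Some k)]/(grover R dom guess z0 ((3 ^ k).-1./2)).
rewrite !leval_grover; congr leval.
rewrite -[prepare dom z0 (C, F)]/(prepare dom z0 (C, C)).
by elim: (_./2) (prepare _ _ _ _) => //= j IH chi; rewrite IH.
Qed.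

Definition hit_prob f C k : R :=
  \sum_(z | hit dom guess f (C, C) z.1) amp f (Some k) (C, C) z ^+ 2.

Lemma grover_hit_prob f C k z : z.2 = f z.1 -> amp f (Some k) (C, C) z = 0.
Proof. exact: grover_outcome (dom_gt0 _) _ _. Qed.

Lemma hit_prob_bounds f C k : 0 <= hit_prob f C k <= 1.
Proof.
rewrite /hit_prob sumr_ge0 => [/=|z _]; last exact: sqr_ge0.
rewrite -(norm2_amplitude f (Some k) (C, C)).
rewrite [leRHS](bigID (fun z => hit dom guess f (C, C) z.1)) /=.
by rewrite lerDl sumr_ge0 // => z _; exact: sqr_ge0.
Qed.

(** Here [b] bounds the failure after the searches. A miss keeps [f] in [F], so an undecided stage
    stays undecided only if all searches in [l] miss, and the miss probabilities multiply. *)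
Lemma searches_success f C rest b l F : 0 <= b <= 1 ->
  (forall F', F' \subset C -> good f C F' -> 1 - b <= success f rest (C, F')) ->
  F \subset C -> f \in F ->
  1 - b - (if good f C F then 0 else \prod_(k <- l) (1 - hit_prob f C k))
    <= success f (map Some l ++ rest) (C, F).
Proof.
move=> /andP[b0 b1] restP; elim: l F => [|k l IH] F sFC fF.
  rewrite big_nil /=; case: ifPn => [gF|_]; first by rewrite subr0 restP.
  by apply: (le_trans _ (success_ge0 _ _ _)); lra.
set P := \prod_(k <- l) _ in IH.
have P0 : 0 <= P.
  by apply: prodr_ge0 => j _; have /andP[_] := hit_prob_bounds f C j; lra.
rewrite big_cons -/P /=.
pose g (z : Z) := good f C F || hit dom guess f (C, C) z.1.
pose err z : R := if g z then 0 else P.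
have : \sum_z amp f (Some k) (C, C) z ^+ 2 * (1 - b - err z) <=
    success f (map Some (k :: l) ++ rest) (C, F).
  (* Outcomes with [f z.1 = z.2] have amplitude 0; all others keep [f] in [F']. *)
  rewrite /=; apply: ler_sum => z _; have [fz|fz] := eqVneq (f z.1) z.2.
    by rewrite amplitude_fst grover_hit_prob ?fz // expr0n !mul0r.
  have {}fz : f z.1 = ~~ z.2 by move: fz; case: (f z.1) (z.2) => -[].
  rewrite amplitude_fst ler_wpM2l ?sqr_ge0 //.
  set F' := [set g in F | _]%SET.
  have sF' : F' \subset F by apply/fintype.subsetP => h; rewrite inE => /andP[].
  apply: le_trans (IH F' (fintype.subset_trans sF' sFC) _); last first.
    by rewrite inE fF fz eqxx.
  rewrite /err /g; case: ifPn => [gz|_].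
    by have := good_next k sFC fF fz gz => /= ->.
  by case: ifP => _; lra.
apply: le_trans.
have -> : \sum_z amp f (Some k) (C, C) z ^+ 2 * (1 - b - err z) =
  1 - b - P * \sum_(z | ~~ g z) amp f (Some k) (C, C) z ^+ 2.
  rewrite mulr_sumr [in RHS]big_mkcond -[1 - b in RHS]mul1r.
  rewrite -(norm2_amplitude f (Some k) (C, C)) mulr_suml -sumrB.
  by apply: eq_bigr => z _; rewrite /err; case: (g z) => /=; ring.
rewrite lerD2l lerN2; rewrite /g; case: ifPn => gF.
  by rewrite big_pred0 ?mulr0.
rewrite mulrC ler_wpM2r // -(norm2_amplitude f (Some k) (C, C)).
rewrite [in leRHS](bigID (fun z => hit dom guess f (C, C) z.1)) /=.
by rewrite /hit_prob addrC addrK.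
Qed.

Definition stage_error (rho : nat) : R := (3 / 4) ^+ rho.

(** Each sweep over [k = 0, ..., L] contains a search that hits with probability at least 1/4; the
    other factors are at most 1. *)
Lemma prod_searches f C rho : (0 < #|hit dom guess f (C, C)|)%N ->
  \prod_(k <- searches rho) (1 - hit_prob f C k) <= stage_error rho.
Proof.
move=> hit_gt0.
have dom_le : (#|dom (C, C)| <= 9 ^ L)%N by exact: blk_le.
have [k le_kL qk] := grover_amplification R z0 dom_le hit_gt0.
have q_bounds j : 0 <= 1 - hit_prob f C j <= 1.
  by have /andP[] := hit_prob_bounds f C j; lra.
have group : \prod_(k <- iota 0 L.+1) (1 - hit_prob f C k) <= 3 / 4.
  rewrite (bigD1_seq k) ?iota_uniq ?mem_iota //=.
  apply: (@le_trans _ _ (1 - hit_prob f C k)); last first.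
    by move: qk; rewrite -/(hit_prob f C k); lra.
  rewrite ler_piMr //; first by case/andP: (q_bounds k).
  by apply: prodr_ile1 => j _.
rewrite /searches /stage_error; elim: rho => [|rho IH].
  by rewrite big_nil expr0.
rewrite -[flatten (nseq rho.+1 _)]/(iota 0 L.+1 ++ flatten (nseq rho _)).
rewrite big_cat exprS ler_pM ?prodr_ge0 // => j _.
  by case/andP: (q_bounds j).
by case/andP: (q_bounds j).
Qed.

Definition nonconstant C : pred 'I_K :=
  fun j => [exists x, (blk x == j) && split_at C x].

(** The potential that bounds the remaining stages: halving lowers the first summand, settling a
    block the second. *)
Definition measure C : nat := (trunc_log 2 #|C| + #|nonconstant C|)%N.

Lemma split_atP C x : reflect
  (exists g g', [/\ g \in C, g' \in C & g x != g' x]) (split_at C x).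
Proof.
apply: (iffP existsP) => [[g /andP[gC /existsP[g' /andP[g'C gg']]]]|].
  by exists g, g'.
move=> [g [g' [gC g'C gg']]]; exists g; rewrite gC.
by apply/existsP; exists g'; rewrite g'C.
Qed.

Lemma subset_split_at C C' x : C' \subset C -> split_at C' x -> split_at C x.
Proof.
move=> sC /split_atP[g [g' [gC g'C gg']]]; apply/split_atP.
by exists g, g'; split=> //; exact: (fintype.subsetP sC).
Qed.

Lemma subset_nonconstant C C' :
  C' \subset C -> {subset nonconstant C' <= nonconstant C}.
Proof.
move=> sC j /existsP[x /andP[xj sx]]; apply/existsP.
by exists x; rewrite xj (subset_split_at sC sx).
Qed.

Lemma no_split C f g :
  f \in C -> g \in C -> (forall x, ~~ split_at C x) -> g = f.
Proof.
move=> fC gC ns; apply/ffunP => x; apply/eqP/negPn/negP => gf.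
by have /negP := ns x; apply; apply/split_atP; exists g, f.
Qed.

Lemma sub_commit C F : F \subset C -> commit (C, F) \subset C.
Proof.
rewrite /commit; case: ifP => //= _ _.
by apply/fintype.subsetP => g; rewrite inE => /andP[].
Qed.

Lemma mem_commit f C F : F \subset C -> good f C F -> f \in commit (C, F).
Proof.
move=> sFC /andP[fF]; rewrite /commit /=; case: ifP => //= _ no_hit.
rewrite inE (fintype.subsetP sFC) //=; apply/'forall_implyP => x xD.
apply: contraLR no_hit => ne; rewrite -lt0n; apply/card_gt0P; exists x.
by rewrite unfold_in /hit xD.
Qed.

Lemma measure_commit f C F T : F \subset C -> good f C F ->
  (measure C <= T.+1)%N -> (measure (commit (C, F)) <= T)%N.
Proof.
move=> sFC gF; have fC' := mem_commit sFC gF; have sC' := sub_commit sFC.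
set C' := commit (C, F) in fC' sC' *; have fF : f \in F by case/andP: gF.
have fC := fintype.subsetP sFC _ fF.
have le_log : (trunc_log 2 #|C'| <= trunc_log 2 #|C|)%N.
  by apply: leq_trunc_log; exact: subset_leq_card.
have le_nc : (#|nonconstant C'| <= #|nonconstant C|)%N.
  by apply: subset_leq_card; apply/fintype.subsetP; exact: subset_nonconstant.
(* Without a split only [f] is left, and the new measure is 0 for any [T]. *)
have [/existsP[x sx]|] := boolP [exists x, split_at C x]; last first.
  rewrite negb_exists => /forallP ns _.
  have C'1 g : g \in C' -> g = f.
    by move=> gC'; apply: (no_split fC) ns; exact: (fintype.subsetP sC').
  have -> : C' = [set f]%SET.
    apply/setP => g; rewrite inE; apply/idP/eqP => [/C'1|->] //.
  rewrite /measure cards1 trunc_log1 add0n eq_card0 // => j.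
  apply/negbTE/negP => /existsP[y /andP[_ /split_atP[g [g' []]]]].
  by rewrite !inE => /eqP-> /eqP->; rewrite eqxx.
rewrite /measure => leT; suff : (trunc_log 2 #|C'| < trunc_log 2 #|C|)%N \/
    (#|nonconstant C'| < #|nonconstant C|)%N by lia.
rewrite /C' /commit /=; case: ifP => [le_F|_].
  left; have F_gt0 : (0 < #|F|)%N by apply/card_gt0P; exists f.
  by rewrite -ltnS -(trunc_logMp (p := 2)) // ltnS leq_trunc_log.
(* All of [agree C] equals the majority on the block of the witness, which thus ceases to be
   nonconstant. *)
right; apply: proper_card; apply/fintype.properP; split.
  apply/fintype.subsetP; apply: subset_nonconstant.
  by apply/fintype.subsetP => g; rewrite inE => /andP[].
have sw : split_at C (witness C).
  by rewrite /witness; case: pickP => //= /(_ x); rewrite sx.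
exists (blk (witness C)).
  by apply/existsP; exists (witness C); rewrite eqxx.
apply/negP => /existsP[y /andP[yw /split_atP[g [g' []]]]].
rewrite !inE => /andP[_ /'forall_implyP gm] /andP[_ /'forall_implyP g'm].
have yD : y \in dom (C, C) by rewrite inE.
by rewrite (eqP (gm y yD)) (eqP (g'm y yD)) eqxx.
Qed.

(** A union bound over the stages; at measure 0 nothing splits [C], so [dec] returns [f]. *)
Lemma stages_success f rho T C : f \in C -> (measure C <= T)%N ->
  1 - T%:R * stage_error rho <= success f (stages rho T) (C, C).
Proof.
have e0 : 0 <= stage_error rho by rewrite exprn_ge0 // divr_ge0.
elim: T C => [|T IH] C fC mC.
  rewrite mul0r subr0 /= /dec /=.
  case: pickP => [g gC|/(_ f)]; last by rewrite fC.
  rewrite (no_split fC gC) ?eqxx // => x; apply/negP => sx.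
  move: mC; rewrite leqn0 addn_eq0 => /andP[_].
  move=> /eqP/card0_eq/(_ (blk x))/negbT/negP.
  by apply; apply/existsP; exists x; rewrite eqxx.
(* For [T%:R * stage_error rho > 1] the claimed bound is negative; otherwise it can serve as [b] in
   [searches_success]. *)
have [b1|b1] := ltP (1 : R) (T%:R * stage_error rho).
  apply: le_trans (success_ge0 _ _ _).
  by rewrite -natr1 mulrDl mul1r; lra.
have b_int : 0 <= T%:R * stage_error rho <= 1 by rewrite b1 mulr_ge0.
rewrite /stages /= -/(stages rho T) /stage cat_rcons.
have restP F' : F' \subset C -> good f C F' ->
    1 - T%:R * stage_error rho <= success f (None :: stages rho T) (C, F').
  move=> sF' gF'; rewrite [leRHS](_ : _ = success f (stages rho T)
      (commit (C, F'), commit (C, F'))).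
    apply: IH; first exact: (mem_commit sF' gF').
    exact: (measure_commit sF' gF' mC).
  (* The program of [None] is empty, so its only outcome is [z0]. *)
  rewrite /=; under eq_bigr do rewrite expr2 -mulrA.
  by rewrite /amplitude /= sum_delta /delta eqxx mul1r.
apply: le_trans (searches_success (searches rho) b_int restP (subxx _) fC).
rewrite -natr1 mulrDl mul1r opprD addrA lerD2l lerN2.
case: ifPn => //; rewrite /good fC /= negb_or -lt0n => /andP[_].
exact: prod_searches.
Qed.

End Halving.

(** * Query count and choice of parameters *)

Lemma big_flatten_nseq (I : Type) (m : nat) (s : seq I) (F : I -> nat) :
  (\sum_(i <- flatten (nseq m s)) F i = m * \sum_(i <- s) F i)%N.
Proof.
elim: m => [|m IH]; first by rewrite big_nil.
by rewrite -[flatten _]/(s ++ flatten (nseq m s)) big_cat IH mulSn.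
Qed.

(** A sweep costs a geometric sum: [(3 ^ k - 1) / 2 + 1] queries over [k <= L] add up to at most
    [2 * 3 ^ L]. *)
Lemma queries_stages (R : realType) (n K L rho T : nat)
    (blk : n.-tuple bool -> 'I_K) :
  (\sum_(i <- stages L rho T) queries (prog R blk i)
     <= T * (rho * (2 * 3 ^ L)))%N.
Proof.
rewrite big_flatten_nseq leq_mul2l; apply/orP; right.
rewrite /stage big_rcons /= addn0 big_map /searches big_flatten_nseq leq_mul2l.
apply/orP; right; rewrite -[iota _ _]/(index_iota 0 L.+1).
under eq_bigr do rewrite queries_grover.
elim: L => [|L IH]; first by rewrite big_nat1.
rewrite big_nat_recr //= expnS.
have := odd_half_pow3 L.+1; rewrite expnS => pow3.
by move: IH; lia.
Qed.

Lemma query_complexity_le (R : realType) (n : nat) (S : {set oracle n}) t :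
  identifiable R S t -> (query_complexity R S <= t%:R%:E)%E.
Proof.
move=> tP; rewrite /query_complexity; case: pselect => [ex|]; last first.
  by case; exists t; apply/asboolP.
by rewrite lee_fin ler_nat; case: ex_minnP => m _; apply; apply/asboolP.
Qed.

(** The initial measure is at most [K + K], one [K] for the logarithm and one for the blocks, so
    [2 * K] stages suffice. *)
Lemma identification (R : realType) (n K L rho : nat)
    (blk : n.-tuple bool -> 'I_K) (S : {set oracle n}) :
  (forall j, (#|[set x | blk x == j]%SET| <= 9 ^ L)%N) ->
  (trunc_log 2 #|S| <= K)%N ->
  (2 * K)%:R * stage_error R rho <= 1 / 3 ->
  (query_complexity R S <= (2 * K * (rho * (2 * 3 ^ L)))%:R%:E)%E.
Proof.
move=> blk_le logS err.
have [A AE] := adaptive_algorithm (next blk) (z0 n) (S, S) (@dec n)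
  (prog_valid R blk) None (stages L rho (2 * K)).
pose t := (\sum_(i <- stages L rho (2 * K)) queries (prog R blk i))%N.
apply: (le_trans (query_complexity_le (t := t) _)).
  exists A => f fS; rewrite AE.
  have -> : 2 / 3 = (2 / 3)%:C :> R[i].
    by rewrite rmorphM fmorphV !rmorph_nat.
  rewrite lecR; apply: le_trans (stages_success R blk_le rho fS _); last first.
    rewrite /measure mul2n -addnn leq_add // -[leqRHS]card_ord.
    exact: max_card.
  lra.
by rewrite lee_fin ler_nat; exact: queries_stages.
Qed.

(** Blocks are intervals of at most [B] consecutive ranks; the rank modulo [B] is injective on
    each. *)
Lemma block_partition (n K : nat) : (0 < K)%N ->
  exists blk : n.-tuple bool -> 'I_K,
    forall j, (#|[set x | blk x == j]%SET| <= (2 ^ n %/ K).+1)%N.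
Proof.
move=> K_gt0; set B := (2 ^ n %/ K).+1.
have blkP (x : n.-tuple bool) : (enum_rank x %/ B < K)%N.
  rewrite ltn_divLR // mulnC; apply: leq_trans (ltn_ord _) _.
  by rewrite card_tuple card_bool ltnW // /B ltn_ceil.
exists (fun x => Ordinal (blkP x)) => j.
pose residue (x : n.-tuple bool) : 'I_B := inord (enum_rank x %% B).
rewrite -(card_in_imset (f := residue)).
  by rewrite (leq_trans (max_card _)) // card_ord.
move=> x y; rewrite !inE => /eqP xj /eqP yj /(congr1 val) /=.
rewrite !inordK ?ltn_pmod // => xy; apply/enum_rank_inj/val_inj.
rewrite /= (divn_eq (enum_rank x) B) (divn_eq (enum_rank y) B) xy.
congr (_ * _ + _)%N.
by have /(congr1 val) := etrans xj (esym yj).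
Qed.

Lemma le_log2 (R : realType) (k : nat) (y : R) : 2 ^+ k <= y -> k%:R <= log2 y.
Proof.
move=> le_y; have ln2 : 0 < ln (2 : R) by rewrite ln_gt0 // ltr1n.
rewrite /log2 ler_pdivlMr // mulr_natl -lnXn //.
by rewrite ler_ln // ?posrE ?exprn_gt0 // (lt_le_trans _ le_y) // exprn_gt0.
Qed.

(** Since [(3 / 4) ^ 3 <= 1 / 2], the stage error is at most [2 ^ (- r) <= 1 / (6 * K)]. *)
Lemma small_stage_error (R : realType) K : (0 < K)%N ->
  (2 * K)%:R * stage_error R (3 * up_log 2 (6 * K)) <= 1 / 3.
Proof.
move=> K_gt0; set r := up_log 2 _.
have r_ge : (6 * K)%:R <= 2 ^+ r :> R by rewrite -natrX ler_nat up_logP.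
have err : stage_error R (3 * r) <= (1 / 2) ^+ r.
  rewrite /stage_error exprM lerXn2r ?nnegrE ?exprn_ge0 ?divr_ge0 //.
  by rewrite !exprS expr0; lra.
apply: le_trans (ler_wpM2l (ler0n _ _) err) _.
rewrite div1r exprVn ler_pdivrMr ?exprn_gt0 //.
by move: r_ge; rewrite !natrM; lra.
Qed.

Theorem theorem1 (R : realType) :
  exists (C : R) (N0 : nat), 0 < C /\
    forall (n N : nat), N = (2 ^ n)%N -> (N0 <= N)%N ->
    forall M : nat, (N < M)%N -> (M <= 2 ^ N)%N ->
    forall S : {set oracle n}, #|S| = M ->
    (query_complexity R S <=
       (C * Num.sqrt (N%:R * log2 (M%:R : R) * log2 (N%:R : R))
          * log2 (log2 (M%:R : R)))%:E)%E.
Proof.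
(* [300 = 12 * 5 * 5]. The threshold 4 gives [K >= 2], hence [log2 logM >= 1]. *)
exists 300, 4%N; split=> // n N NE N_ge4 M ltNM leM S SM.
have M_gt0 : (0 < M)%N by exact: leq_ltn_trans ltNM.
set K := trunc_log 2 M.
have K_ge2 : (2 <= K)%N by apply: trunc_log_max => //; lia.
have K_le : (K <= N)%N by rewrite -(trunc_expnK (p := 2) N) // leq_trunc_log.
have [blk blk_le] := block_partition n (ltnW K_ge2).
set B := (2 ^ n %/ K).+1 in blk_le.
set L := up_log 9 B; set r := up_log 2 (6 * K).
(* Rounding the block size up adds at most [K <= N]. *)
have KB : (K * B <= 2 * N)%N.
  by rewrite /B mulnS mulnC -NE; have := leq_trunc_div N K; lia.
have L_le : (9 ^ L <= 9 * B)%N.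
  have [B1|B1] := ltnP 1 B; last by rewrite /L (_ : B = 1)%N ?up_log1 //; lia.
  have := up_log_gtn (p := 9) isT B1; rewrite -/L.
  by case: (L) => [|L'] /=; rewrite ?expnS; lia.
have := @identification R n K L (3 * r) blk S _ _ _.
rewrite SM => /(_ _ (leqnn _) (small_stage_error R (ltnW K_ge2))).
have blk_le' j : (#|[set x | blk x == j]%SET| <= 9 ^ L)%N.
  exact: leq_trans (blk_le j) (up_logP _ _).
move=> /(_ blk_le') => le_t; apply: le_trans le_t _; rewrite lee_fin.
set logM := log2 (M%:R : R); set logN := log2 (N%:R : R).
have K_log : K%:R <= logM by apply: le_log2; rewrite -natrX ler_nat trunc_logP.
have logM_ge2 : 2 <= logM by apply: le_trans K_log; rewrite ler_nat.
have loglog_ge1 : 1 <= log2 logM by apply: (@le_log2 _ 1); rewrite expr1.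
have logN_ge1 : 1 <= logN.
  by apply: (@le_log2 _ 1); rewrite expr1 ler_nat (leq_trans _ N_ge4).
(* For [r > 4], minimality of [r] gives [8 * 2 ^ (r - 4) < 6 * K], so [r - 4 <= log2 logM]; the
   summand 4 is absorbed by [log2 logM >= 1]. *)
have r_le : r%:R <= 5 * log2 logM.
  suff : r%:R <= 4 + log2 logM by lra.
  have [r4|r4] := leqP r 4.
    by apply: (@le_trans _ _ 4%:R); rewrite ?ler_nat //; lra.
  rewrite -(subnKC (ltnW r4)) natrD lerD2l; apply: le_log2.
  have : (2 ^ r.-1 < 6 * K)%N by apply: up_log_gtn => //; lia.
  have -> : (r.-1 = 3 + (r - 4))%N by lia.
  rewrite -(ltr_nat R) natrX exprD natrM; move: K_log.
  have : (0 : R) < 2 ^+ (r - 4) by rewrite exprn_gt0.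
  by lra.
(* After squaring: [K ^ 2 * 9 ^ L <= 9 * K * (K * B) <= 18 * N * K], and [18 <= 25]. *)
have KL_le : (K * 3 ^ L)%:R <= 5 * Num.sqrt (N%:R * logM * logN).
  have nn : 0 <= N%:R * logM * logN.
    by apply: mulr_ge0; [apply: mulr_ge0 => // |]; lra.
  rewrite -[_ <= _](ler_pXn2r (n := 2)) ?nnegrE ?mulr_ge0 ?sqrtr_ge0 //.
  rewrite exprMn sqr_sqrtr // -natrX expnMn -expnM [(L * 2)%N]mulnC expnM.
  have : (K ^ 2 * 9 ^ L <= 18 * (N * K))%N by nia.
  rewrite -(ler_nat R) => /le_trans; apply.
  apply: (@le_trans _ _ (18 * (N%:R * logM))).
    by rewrite !natrM ler_wpM2l // ler_wpM2l.
  have : 0 <= N%:R * logM by apply: mulr_ge0 => //; lra.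
  by nra.
have -> : (2 * K * (3 * r * (2 * 3 ^ L)))%:R = 12 * (K * 3 ^ L)%:R * r%:R :> R.
  by rewrite !natrM; ring.
apply: (@le_trans _ _
  (12 * (5 * Num.sqrt (N%:R * logM * logN)) * (5 * log2 logM))).
  by rewrite ler_pM // ?mulr_ge0 // ler_wpM2l.
by rewrite le_eqVlt; apply/orP; left; apply/eqP; ring.
Qed.
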